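(* Let $a,b$ be real numbers with $0<a<b$. Then $$\left|\frac{1}{L(a,b)}-\frac{1}{H(a,b)}-\frac{1}{2A(a,b)}\right|\le\left(\frac{5}{48}a+\frac{7}{48}b\right)\frac{1}{a^{2}}+\left(\frac{7}{48}a+\frac{5}{48}b\right)\frac{1}{b^{2}} .$$
   Context: For $0<a<b$: $A(a,b)=\frac{a+b}{2}$ (arithmetic mean), $H(a,b)=\frac{2ab}{a+b}$ (harmonic mean), $L(a,b)=\frac{b-a}{\ln b-\ln a}$ (logarithmic mean). *)

(* Defs.v *)
From Stdlib Require Import Reals.
Open Scope R_scope.

Definition arith_mean (a b : R) : R := (a + b) / 2.

Definition harm_mean (a b : R) : R := 2 * a * b / (a + b).

(* Only meaningful for positive [a <> b]; at [a = b] the value is not the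
   usual continuous extension [a]. *)
Definition log_mean (a b : R) : R := (b - a) / (ln b - ln a).

(* Main.v *)
Require Import Defs.
From Stdlib Require Import Reals Lra.
From Coquelicot Require Import Coquelicot.
Open Scope R_scope.

(** Since a <= L(a,b) <= A(a,b), replacing 1/L by 1/A or by 1/a bounds the
    left-hand side from below and above, in both cases by
    (a^2 + b^2) / (2ab(a+b)) in absolute value.  After clearing denominators,
    comparing this with the right-hand side amounts to
    (a-b)^2 (7a^2 + 2ab + 7b^2) >= 0. *)

(** This is L <= A with denominators cleared. With [a] fixed, ln x - ln a - 2(x-a)/(x+a) vanishes at
    x = a and has derivative 1/x - 4a/(x+a)^2 = (x-a)^2/(x(x+a)^2) >= 0, so the mean value theorem
    makes it nonnegative at [b]. *)
Lemma ln_sub_ge (a b : R) :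
  0 < a -> a < b -> 2 * (b - a) / (b + a) <= ln b - ln a.
Proof.
  intros ha hab.
  destruct (MVT_cor2 (fun x => ln x - 2 * (x - a) / (x + a))
              (fun x => (x - a) ^ 2 / (x * (x + a) ^ 2)) a b hab) as (c & Hc & Hac & _).
  - intros c Hc.
    apply is_derive_Reals.
    auto_derive; [repeat split; lra | field; split; lra].
  - assert (0 <= (c - a) ^ 2 / (c * (c + a) ^ 2)).
    { apply Rdiv_le_0_compat; [apply pow2_ge_0 |].
      apply Rmult_lt_0_compat; [| apply pow_lt]; lra. }
    replace (2 * (a - a) / (a + a)) with 0 in Hc by (field; lra).
    nra.
Qed.

Lemma inv_log_mean_ge (a b : R) :
  0 < a -> a < b -> 2 / (a + b) <= 1 / log_mean a b.
Proof.
  intros ha hab.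
  pose proof (ln_sub_ge a b ha hab).
  pose proof (ln_increasing a b ha hab).
  unfold log_mean.
  replace (1 / ((b - a) / (ln b - ln a))) with ((ln b - ln a) / (b - a))
    by (field; lra).
  apply (Rle_div_r _ _ (b - a)); [lra |].
  replace (2 / (a + b) * (b - a)) with (2 * (b - a) / (b + a)) by (field; lra).
  assumption.
Qed.

Lemma inv_log_mean_le (a b : R) :
  0 < a -> a < b -> 1 / log_mean a b <= 1 / a.
Proof.
  intros ha hab.
  pose proof (ln_increasing a b ha hab).
  (* The inequality 1 + t <= exp t at t = ln(b/a) gives ln b - ln a <= b/a - 1, which is the claim
     multiplied by b - a. *)
  pose proof (exp_ineq1_le (ln (b / a))) as He.
  rewrite exp_ln in He by (apply Rdiv_lt_0_compat; lra).
  rewrite ln_div in He by lra.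
  unfold log_mean.
  replace (1 / ((b - a) / (ln b - ln a))) with ((ln b - ln a) / (b - a))
    by (field; lra).
  apply (Rle_div_l _ _ (b - a)); [lra |].
  replace (1 / a * (b - a)) with (b / a - 1) by (field; lra).
  lra.
Qed.

(** Both sides are symmetric and agree at a = b, which explains the factor (a-b)^2 in their
    difference; its cofactor has only positive coefficients. *)
Lemma sum_squares_bound (a b : R) :
  0 < a -> 0 < b ->
  (a ^ 2 + b ^ 2) / (2 * a * b * (a + b))
  <= (5 / 48 * a + 7 / 48 * b) * (1 / a ^ 2)
     + (7 / 48 * a + 5 / 48 * b) * (1 / b ^ 2).
Proof.
  intros ha hb.
  apply Rminus_le_0.
  replace (_ - _) with
    ((a - b) ^ 2 * (7 * a ^ 2 + 2 * (a * b) + 7 * b ^ 2)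
     / (48 * (a ^ 2 * b ^ 2 * (a + b)))) by (field; lra).
  apply Rdiv_le_0_compat.
  - apply Rmult_le_pos; [apply pow2_ge_0 | nra].
  - repeat (apply Rmult_lt_0_compat || apply pow_lt); lra.
Qed.

Theorem proposition1 (a b : R) (ha : 0 < a) (hab : a < b) :
  Rabs (1 / log_mean a b - 1 / harm_mean a b - 1 / (2 * arith_mean a b))
  <= (5 / 48 * a + 7 / 48 * b) * (1 / a ^ 2)
     + (7 / 48 * a + 5 / 48 * b) * (1 / b ^ 2).
Proof.
  apply Rle_trans with ((a ^ 2 + b ^ 2) / (2 * a * b * (a + b)));
    [| apply sum_squares_bound; lra].
  pose proof (inv_log_mean_ge a b ha hab) as Hlow.
  pose proof (inv_log_mean_le a b ha hab) as Hup.
  unfold harm_mean, arith_mean.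
  set (M := (a ^ 2 + b ^ 2) / (2 * a * b * (a + b))).
  (* Replacing 1/L by its lower bound 1/A gives exactly [- M]. *)
  assert (Elow : 2 / (a + b) - 1 / (2 * a * b / (a + b)) - 1 / (2 * ((a + b) / 2)) = - M)
    by (unfold M; field; lra).
  (* Replacing 1/L by 1/a gives M - 1/b, so the upper half holds with slack 1/b > 0. *)
  assert (Eup : M - (1 / a - 1 / (2 * a * b / (a + b)) - 1 / (2 * ((a + b) / 2))) = / b)
    by (unfold M; field; lra).
  assert (0 < / b) by (apply Rinv_0_lt_compat; lra).
  apply Rabs_le; lra.
Qed.
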